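(* Let $\Delta\ge 3$ and $n\ge 3$. There exists an execution of the traversal procedure on $T_{n,\Delta}$ (i.e. a suitable choice of the children in step (b) and of the unmarked leaves in step (c)) whose output graph $G$ is planar. Consequently there is a planar hamiltonian graph on $n$ vertices with maximum degree at most $\Delta$ and diameter at most $2\,h(n,\Delta)$.
   Context: Fix integers $\Delta\ge 3$ and $n\ge 3$, and put $b=\Delta-1$. The complete $\Delta$-ary tree $T_{n,\Delta}$ is the rooted tree on vertex set $\{1,\dots,n\}$ with root $1$ in which the children of a vertex $i$ are the integers $j$ with $b(i-1)+2\le j\le bi+1$ and $j\le n$ (equivalently, the parent of $j\ge 2$ is $\lfloor (j-2)/b\rfloor+1$). Thus every vertex has at most $\Delta-1$ children, all levels except possibly the last are full, and the last level is filled from the left. A leaf is a vertex other than the root having no children. The height $h(n,\Delta)$ of $T_{n,\Delta}$ is the largest distance from the root to a vertex. Traversal procedure: start with edge set $E$ equal to the edge set of $T_{n,\Delta}$, all vertices unmarked, and $v_1=1$. For $k=1,\dots,n-1$: mark $v_k$; then (a) if $v_k\neq 1$ and the parent of $v_k$ is unmarked, let $v_{k+1}$ be the parent of $v_k$; (b) otherwise, if $v_k$ has an unmarked child, let $v_{k+1}$ be any unmarked child of $v_k$; (c) otherwise, let $v_{k+1}$ be any unmarked leaf $u$ and add the edge $\{v_k,u\}$ to $E$ (a ''jump edge''). Finally mark $v_n$ and add the edge $\{v_n,1\}$ to $E$ (if not already present). The output is the simple graph $G=(\{1,\dots,n\},E)$. An execution is any run of this procedure, i.e. any admissible sequence of choices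 in (b) and (c). *)

(* Defs.v *)
From Stdlib Require Import Reals Arith List Lia Bool.
Local Open Scope nat_scope.
Open Scope bool_scope.
Import ListNotations.

Definition par (D j : nat) : nat := (j - 2) / (D - 1) + 1.

Definition is_child (D n i j : nat) : bool :=
  (1 <=? i) && ((D - 1) * (i - 1) + 2 <=? j) && (j <=? (D - 1) * i + 1) && (j <=? n).

Definition is_leaf (D n u : nat) : bool :=
  (2 <=? u) && (u <=? n) && negb (existsb (is_child D n u) (seq 1 n)).

Fixpoint depth_aux (D fuel j : nat) : nat :=
  match fuel with
  | 0 => 0
  | S f => if j <=? 1 then 0 else S (depth_aux D f (par D j))
  end.
Definition depth (D j : nat) : nat := depth_aux D j j.

Definition height (D n : nat) : nat := fold_right max 0 (map (depth D) (seq 1 n)).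

(* v_1, ..., v_k are marked after step k (a run is a sequence v : nat -> nat, indices 1..n) *)
Definition marked (v : nat -> nat) (k x : nat) : bool :=
  existsb (fun i => v i =? x) (seq 1 k).

Definition caseA (D : nat) (v : nat -> nat) (k : nat) : bool :=
  negb (v k =? 1) && negb (marked v k (par D (v k))).

Definition caseB (D n : nat) (v : nat -> nat) (k : nat) : bool :=
  existsb (fun j => is_child D n (v k) j && negb (marked v k j)) (seq 1 n).

Definition jump (D n : nat) (v : nat -> nat) (k : nat) : bool :=
  negb (caseA D v k) && negb (caseB D n v k).

Definition execution (D n : nat) (v : nat -> nat) : Prop :=
  v 1 = 1 /\
  forall k, 1 <= k -> k < n ->
    if caseA D v k then v (S k) = par D (v k)
    else if caseB D n v k then
      is_child D n (v k) (v (S k)) = true /\ marked v k (v (S k)) = false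
    else is_leaf D n (v (S k)) = true /\ marked v k (v (S k)) = false.

Definition output (D n : nat) (v : nat -> nat) (x y : nat) : bool :=
  (1 <=? x) && (x <=? n) && (1 <=? y) && (y <=? n) && negb (x =? y) &&
  ( is_child D n x y || is_child D n y x
    || existsb (fun k => jump D n v k &&
                  (((v k =? x) && (v (S k) =? y)) || ((v k =? y) && (v (S k) =? x))))
               (seq 1 (n - 1))
    || ((v n =? x) && (y =? 1)) || ((v n =? y) && (x =? 1)) ).

Definition simple_graph (n : nat) (E : nat -> nat -> bool) : Prop :=
  (forall x y, E x y = true -> 1 <= x <= n /\ 1 <= y <= n) /\
  (forall x y, E x y = E y x) /\
  (forall x, E x x = false).

Fixpoint walk (E : nat -> nat -> bool) (x : nat) (p : list nat) (y : nat) : bool :=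
  match p with
  | [] => x =? y
  | z :: p' => E x z && walk E z p' y
  end.

Definition diameter_le (n : nat) (E : nat -> nat -> bool) (d : nat) : Prop :=
  forall x y, 1 <= x <= n -> 1 <= y <= n ->
    exists p, length p <= d /\ walk E x p y = true.

Definition max_degree_le (n : nat) (E : nat -> nat -> bool) (d : nat) : Prop :=
  forall x, 1 <= x <= n -> length (filter (E x) (seq 1 n)) <= d.

Definition hamiltonian (n : nat) (E : nat -> nat -> bool) : Prop :=
  exists x0 c, NoDup (x0 :: c) /\ length (x0 :: c) = n /\
    (forall x, In x (x0 :: c) -> 1 <= x <= n) /\
    walk E x0 c (last c x0) = true /\ E (last c x0) x0 = true.

(* ---------- Planarity (Diestel: drawing with polygonal arcs) ---------- *)

Definition pt := (R * R)%type.

Definition lerp (a b : pt) (s : R) : pt :=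
  (fst a + s * (fst b - fst a), snd a + s * (snd b - snd a))%R.

Definition affine_on (g : R -> pt) (t0 t1 : R) : Prop :=
  forall t, (t0 <= t <= t1)%R -> g t = lerp (g t0) (g t1) ((t - t0) / (t1 - t0))%R.

Fixpoint pl_on (g : R -> pt) (t0 : R) (ts : list R) : Prop :=
  match ts with
  | [] => t0 = 1%R
  | t1 :: ts' => (t0 < t1)%R /\ affine_on g t0 t1 /\ pl_on g t1 ts'
  end.

Definition polygonal_arc (g : R -> pt) : Prop :=
  (exists ts, pl_on g 0%R ts) /\
  (forall s s', (0 <= s <= 1)%R -> (0 <= s' <= 1)%R -> g s = g s' -> s = s').

Definition planar (n : nat) (E : nat -> nat -> bool) : Prop :=
  exists (pos : nat -> pt) (arc : nat -> nat -> R -> pt),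
    (forall x y, 1 <= x <= n -> 1 <= y <= n -> pos x = pos y -> x = y) /\
    (forall u w, u < w -> E u w = true ->
       polygonal_arc (arc u w) /\ arc u w 0%R = pos u /\ arc u w 1%R = pos w /\
       (forall s x, (0 < s < 1)%R -> 1 <= x <= n -> arc u w s <> pos x)) /\
    (forall u w u' w', u < w -> E u w = true -> u' < w' -> E u' w' = true ->
       (u, w) <> (u', w') ->
       forall s s', (0 < s < 1)%R -> (0 <= s' <= 1)%R -> arc u w s <> arc u' w' s').

(* Main.v *)
Require Import Defs.
From Stdlib Require Import Reals Arith List Lia.
From Stdlib Require Import Bool Permutation Sorted Lra.
Import ListNotations.
Local Open Scope nat_scope.

(** Put the vertices on a line in the order in which they are visited. The
    tree edges that are not followed by the traversal must then be distributed
    over the two half planes (pages) so that edges of one page do not cross;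
    jump edges join consecutive points and the closing edge spans everything.

    When the traversal jumps into an untouched subtree rooted at [w], it climbs
    from the first leaf to [w] and then descends through the second child of [w].
    If the edge above [w] lies in one page, the subtrees hanging from the climbing
    path are attached in the other page and visited first, from top to bottom; those
    hanging from [w] and the descending path are attached in the page of [w] and
    visited afterwards, from bottom to top. The pending subtrees of each page thus
    form a stack, and a stack discipline excludes crossings within a page. *)

(** * Subtrees and the construction of a run *)

(** Uniqueness of Euclidean division: the interval of children of [i] consists of the [j] for which
    [j - 2] has quotient [i - 1] by [D - 1]. *)
Lemma child_par (D n i j : nat) (hD : 3 <= D) :
  is_child D n i j = true <-> 2 <= j <= n /\ par D j = i.
Proof.
  unfold is_child, par. rewrite !andb_true_iff, !Nat.leb_le.
  split.
  - intros [[[H1 H2] H3] H4]. assert (2 <= j) by nia. split; [lia|].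
    assert ((j - 2) / (D - 1) = i - 1); [|lia].
    destruct i as [|i]; [lia|]. replace (S i - 1) with i in * by lia.
    rewrite Nat.mul_succ_r in H3.
    symmetry. apply (Nat.div_unique _ _ _ (j - 2 - (D - 1) * i)); lia.
  - intros [H1 H2].
    assert (Hm := Nat.div_mod_eq (j - 2) (D - 1)).
    assert (Hb := Nat.mod_upper_bound (j - 2) (D - 1) ltac:(lia)).
    set (q := (j - 2) / (D - 1)) in *. subst i.
    replace (q + 1 - 1) with q by lia. repeat split; try lia; nia.
Qed.

Lemma par_bounds (D j : nat) (hD : 3 <= D) (hj : 2 <= j) : 1 <= par D j < j.
Proof.
  destruct (proj2 (child_par D j (par D j) j hD) ltac:(split; [lia|reflexivity])).
  unfold par. split; [lia|].
  assert ((j - 2) / (D - 1) <= j - 2) by (apply Nat.Div0.div_le_upper_bound; nia). lia.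
Qed.

Definition children (D n i : nat) : list nat := filter (is_child D n i) (seq 1 n).

Lemma in_children (D n i j : nat) (hD : 3 <= D) :
  In j (children D n i) <-> 2 <= j <= n /\ par D j = i.
Proof.
  unfold children. rewrite filter_In, in_seq, (child_par D n i j hD). intuition lia.
Qed.

Lemma in_children_gt (D n i j : nat) (hD : 3 <= D) : In j (children D n i) -> i < j <= n.
Proof.
  intros H. apply in_children in H as [H1 <-]; auto.
  pose proof (par_bounds D j hD). lia.
Qed.

Lemma leaf_children (D n u : nat) :
  is_leaf D n u = true <-> 2 <= u <= n /\ children D n u = [].
Proof.
  unfold is_leaf, children. rewrite !andb_true_iff, !Nat.leb_le, negb_true_iff.
  assert (existsb (is_child D n u) (seq 1 n) = false <-> filter (is_child D n u) (seq 1 n) = []).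
  { induction (seq 1 n) as [|a l IH]; simpl; [intuition|].
    destruct (is_child D n u a); simpl; [split; discriminate|exact IH]. }
  rewrite H. intuition.
Qed.

Lemma NoDup_children (D n i : nat) : NoDup (children D n i).
Proof. apply NoDup_filter, seq_NoDup. Qed.

Lemma length_children (D n i : nat) : length (children D n i) <= D - 1.
Proof.
  rewrite <- (length_seq (D - 1) ((D - 1) * (i - 1) + 2)).
  apply NoDup_incl_length; [apply NoDup_children|].
  intros j Hj. apply filter_In in Hj as [_ Hj]. unfold is_child in Hj.
  rewrite !andb_true_iff, !Nat.leb_le in Hj. apply in_seq.
  destruct i as [|i]; [lia|]. replace (S i - 1) with i in * by lia.
  rewrite Nat.mul_succ_r in Hj. lia.
Qed.

(** Labels increase from parent to child, so fuel [n - w + 1] exhausts the subtree of [w]; [subtree]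
    supplies the uniform value [S n]. *)
Fixpoint subtree_aux (D n fuel w : nat) : list nat :=
  match fuel with
  | 0 => []
  | S f => w :: flat_map (subtree_aux D n f) (children D n w)
  end.

Definition subtree (D n w : nat) : list nat := subtree_aux D n (S n) w.
Definition forest (D n : nat) (l : list nat) : list nat := flat_map (subtree D n) l.

Lemma subtree_aux_fuel (D n : nat) (hD : 3 <= D) (f g w : nat) :
  n < w + f -> n < w + g -> w <= n ->
  subtree_aux D n f w = subtree_aux D n g w.
Proof.
  revert g w. induction f as [|f IH]; intros [|g] w Hf Hg Hw; try lia.
  simpl. f_equal.
  rewrite !flat_map_concat_map. f_equal. apply map_ext_in. intros c Hc.
  apply in_children_gt in Hc; auto. apply IH; lia.
Qed.

Lemma subtree_eq (D n w : nat) (hD : 3 <= D) (hw : 1 <= w <= n) :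
  subtree D n w = w :: forest D n (children D n w).
Proof.
  unfold subtree at 1, forest. simpl. f_equal.
  rewrite !flat_map_concat_map. f_equal. apply map_ext_in. intros c Hc.
  apply in_children_gt in Hc; auto. apply subtree_aux_fuel; auto; lia.
Qed.

Local Notation cnt := (count_occ Nat.eq_dec).

Lemma count_subtree (D n : nat) (hD : 3 <= D) (f w z : nat) :
  n < w + f -> 1 <= w <= n -> 2 <= z <= n ->
  cnt (subtree_aux D n f w) z = (if w =? z then 1 else 0) + cnt (subtree_aux D n f w) (par D z).
Proof.
  revert w. induction f as [|f IH]; intros w Hf Hw Hz; [lia|].
  cbn [subtree_aux].
  assert (H : forall l, (forall c, In c l -> w < c <= n) ->
    cnt (flat_map (subtree_aux D n f) l) z =
    cnt l z + cnt (flat_map (subtree_aux D n f) l) (par D z)).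
  { induction l as [|c l IHl]; intros Hl; simpl; auto.
    pose proof (Hl c (or_introl eq_refl)) as Hc.
    rewrite !count_occ_app, (IHl (fun d h => Hl d (or_intror h))), (IH c) by lia.
    destruct (Nat.eqb_spec c z), (Nat.eq_dec c z); lia. }
  simpl count_occ.
  assert (Hc : cnt (children D n w) z = if Nat.eq_dec w (par D z) then 1 else 0).
  { destruct (Nat.eq_dec w (par D z)) as [e|e].
    - apply NoDup_count_occ'; [apply NoDup_children|]. apply in_children; auto.
    - apply count_occ_not_In. rewrite in_children by auto. intuition. }
  pose proof (H (children D n w) (fun c h => in_children_gt D n w c hD h)) as H1.
  rewrite H1, Hc.
  destruct (Nat.eqb_spec w z), (Nat.eq_dec w z), (Nat.eq_dec w (par D z)); try lia.
Qed.

Lemma subtree_aux_ge (D n : nat) (hD : 3 <= D) (f w z : nat) :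
  w <= n -> In z (subtree_aux D n f w) -> w <= z <= n.
Proof.
  revert w. induction f as [|f IH]; intros w Hw; simpl; [easy|].
  intros [->|H]; [lia|]. apply in_flat_map in H as [c [H1 H2]].
  apply in_children_gt in H1; auto. apply IH in H2; lia.
Qed.

(** By [count_subtree] each vertex inherits its multiplicity from its parent, hence from the root,
    which occurs once because all its descendants have larger labels. *)
Lemma subtree_root_perm (D n : nat) (hD : 3 <= D) (hn : 1 <= n) :
  Permutation (subtree D n 1) (seq 1 n).
Proof.
  apply (Permutation_count_occ Nat.eq_dec). intros z.
  destruct (in_dec Nat.eq_dec z (seq 1 n)) as [H|H].
  - rewrite (proj1 (NoDup_count_occ' Nat.eq_dec (seq 1 n)) (seq_NoDup n 1) z H).
    apply in_seq in H. induction z as [z IH] using lt_wf_ind.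
    destruct (Nat.eq_dec z 1) as [->|Hz].
    + unfold subtree. cbn [subtree_aux].
      rewrite count_occ_cons_eq by reflexivity. f_equal. apply count_occ_not_In.
      intros H1. apply in_flat_map in H1 as [c [H1 H2]].
      apply in_children_gt in H1; auto. apply subtree_aux_ge in H2; auto; lia.
    + unfold subtree in *. rewrite count_subtree by lia.
      pose proof (par_bounds D z hD). rewrite IH by lia.
      destruct (Nat.eqb_spec 1 z); lia.
  - rewrite (proj1 (count_occ_not_In Nat.eq_dec (seq 1 n) z) H). apply count_occ_not_In.
    intros H1. apply H. unfold subtree in H1. apply subtree_aux_ge in H1; auto.
    apply in_seq. lia.
Qed.

(** Rules (a), (b), (c) of the traversal. Each disjunct carries the failure of the earlier rules;
    that [y] is unvisited is required in [reach_step]. *)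
Definition good_step (D n : nat) (M : list nat) (x y : nat) : Prop :=
  (x <> 1 /\ y = par D x) \/
  ((x = 1 \/ In (par D x) M) /\ In y (children D n x)) \/
  (x <> 1 /\ In (par D x) M /\ incl (children D n x) M /\ is_leaf D n y = true).

(* A page is a pair of the stack of pending subtree roots and the list of the roots
   popped so far; visiting [y] may pop [y] itself and may push children of [y]. *)
Inductive stack_step (D n y : nat) : list nat * list nat -> list nat * list nat -> Prop :=
| stack_push a A C : incl a (children D n y) -> stack_step D n y (A, C) (a ++ A, C)
| stack_pop a A C : incl a (children D n y) -> stack_step D n y (y :: A, C) (a ++ A, y :: C).

(* [M] lists the visited vertices, the current one first. The last premise of
   [reach_step] makes every tree edge that is not followed belong to a page. *)
Inductive reach (D n : nat) : list nat -> list nat * list nat -> list nat * list nat -> Prop :=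
| reach_root a b : incl a (children D n 1) -> incl b (children D n 1) ->
    reach D n [1] (a, []) (b, [])
| reach_step x y M s1 s2 t1 t2 :
    reach D n (x :: M) s1 s2 ->
    ~ In y (x :: M) -> 1 <= y <= n ->
    good_step D n (x :: M) x y ->
    stack_step D n y s1 t1 -> stack_step D n y s2 t2 ->
    (In (par D y) (x :: M) -> par D y = x \/ In y (snd t1) \/ In y (snd t2)) ->
    reach D n (y :: x :: M) t1 t2.

Lemma reach_sym (D n : nat) M s1 s2 : reach D n M s1 s2 -> reach D n M s2 s1.
Proof.
  induction 1; econstructor; eauto. intuition.
Qed.

Definition can_jump (D n : nat) (M : list nat) : Prop :=
  exists x M0, M = x :: M0 /\ x <> 1 /\ In (par D x) M /\ incl (children D n x) M.

Lemma reach_stack_par (D n : nat) (hD : 3 <= D) M s1 s2 : reach D n M s1 s2 ->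
  (forall s, In s (fst s1) -> 2 <= s <= n /\ In (par D s) M).
Proof.
  induction 1 as [a b Ha Hb|x y M s1 s2 t1 t2 Hr IH Hy Hyn Hg H1 H2 Hp].
  - intros s Hs. apply Ha in Hs. apply in_children in Hs as [Hs ->]; auto.
    simpl; auto.
  - intros s Hs. inversion H1; subst; simpl in *;
      (apply in_app_iff in Hs as [Hs|Hs];
       [ match goal with H : incl _ _ |- _ => apply H in Hs end;
         apply in_children in Hs as [Hs ->]; auto
       | destruct (IH s ltac:(auto)); intuition ]).
Qed.

(** The unvisited part [X] is carried along as the complement of [M] in a permutation of [seq 1 n];
    distinctness then shows its members to be new. *)
Lemma perm_not_in (M X : list nat) (n z : nat) :
  Permutation (M ++ X) (seq 1 n) -> In z X -> ~ In z M /\ 1 <= z <= n.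
Proof.
  intros HP Hz. split.
  - assert (HN : NoDup (M ++ X)) by (eapply Permutation_NoDup; [symmetry; exact HP|apply seq_NoDup]).
    intros Hm. apply in_split in Hz as [l1 [l2 ->]].
    rewrite app_assoc in HN. apply NoDup_remove_2 in HN. apply HN.
    rewrite !in_app_iff. auto.
  - assert (In z (seq 1 n)) as H by (eapply Permutation_in; [exact HP|apply in_app_iff; auto]).
    apply in_seq in H. lia.
Qed.

(** Comparing multiplicities turns each regrouping of subtrees into linear arithmetic. *)
Ltac perm_tac H :=
  apply (Permutation_count_occ Nat.eq_dec); intros z;
  apply (proj1 (Permutation_count_occ Nat.eq_dec _ _)) with (x := z) in H;
  revert H; unfold forest; cbn [flat_map]; rewrite ?flat_map_app;
  cbn [count_occ app]; rewrite ?count_occ_app; cbn [count_occ app]; rewrite ?count_occ_app;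
  repeat match goal with |- context [Nat.eq_dec ?a z] => destruct (Nat.eq_dec a z) end;
  lia.

(** Jump to the leaf at the end of the first children below [t], then let rule (a) climb back. As
    [par D t] stays in the unvisited part [X], the edge above [t] needs no page yet. *)
Lemma climb (D n : nat) (hD : 3 <= D) (k t : nat) : n - t < k -> 2 <= t <= n ->
  forall M s1 B C X, reach D n M s1 (B, C) -> can_jump D n M ->
  Permutation (M ++ subtree D n t ++ X) (seq 1 n) -> In (par D t) X ->
  exists l M' C', reach D n (t :: M') s1 (l ++ B, C') /\
    Permutation ((t :: M') ++ forest D n l ++ X) (seq 1 n) /\
    (forall s, In s l -> t < s <= n).
Proof.
  revert t. induction k as [|k IH]; intros t Hk Ht M s1 B C X HR HJ HP HX; [lia|].
  rewrite subtree_eq in HP by lia.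
  destruct (children D n t) as [|c cs] eqn:Ec.
  - exists [], M, C. destruct HJ as (x & M0 & -> & Hx & Hpx & Hc).
    destruct (perm_not_in _ _ _ t HP ltac:(simpl; auto)) as [Ht1 _].
    destruct (perm_not_in _ _ _ (par D t) HP ltac:(rewrite !in_app_iff; auto)) as [Ht2 _].
    split; [|split; [perm_tac HP|easy]].
    apply reach_step with s1 (B, C); auto; try lia.
    + right; right. repeat split; auto. rewrite leaf_children. auto.
    + destruct s1 as [A C1]. apply (stack_push D n t [] A C1). easy.
    + apply stack_push. easy.
    + easy.
  - assert (Hc : In c (children D n t)) by (rewrite Ec; simpl; auto).
    assert (Hg := in_children_gt D n t c hD Hc).
    apply in_children in Hc as [Hc1 Hc2]; auto.
    destruct (IH c ltac:(lia) ltac:(lia) M s1 B C (t :: forest D n cs ++ X) HR HJ)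
      as (l & M' & C' & HR' & HP' & Hl).
    { clear - HP. perm_tac HP. }
    { rewrite Hc2. simpl; auto. }
    (* The siblings of [c] hang from [t], visited after everything in [M'], so they go on top of
       [l]. *)
    exists (cs ++ l), (c :: M'), C'.
    destruct (perm_not_in _ _ _ t HP' ltac:(rewrite !in_app_iff; simpl; auto)) as [Ht1 _].
    destruct (perm_not_in _ _ _ (par D t) HP' ltac:(rewrite !in_app_iff; simpl; rewrite in_app_iff; auto)) as [Ht2 _].
    split; [|split].
    + apply reach_step with s1 (l ++ B, C'); auto; try lia.
      * left. split; [lia|auto].
      * destruct s1 as [A C1]. apply (stack_push D n t [] A C1). easy.
      * rewrite <- app_assoc. apply stack_push. rewrite Ec. intros z Hz. right; auto.
      * easy.
    + clear - HP'. perm_tac HP'.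
    + intros s Hs. apply in_app_iff in Hs as [Hs|Hs].
      * apply (in_children_gt D n t); auto. rewrite Ec. right; auto.
      * apply Hl in Hs. lia.
Qed.

(** Rule (b) applies all along the first children; the final leaf has a visited parent and no
    children, so a jump is possible there. *)
Lemma descend (D n : nat) (hD : 3 <= D) (k t : nat) : n - t < k -> 2 <= t <= n ->
  forall x M A C s2 X, reach D n (x :: M) (A, C) s2 -> par D t = x ->
  (x = 1 \/ In (par D x) (x :: M)) ->
  Permutation ((x :: M) ++ subtree D n t ++ X) (seq 1 n) ->
  exists l M' C', reach D n M' (l ++ A, C') s2 /\ can_jump D n M' /\
    Permutation (M' ++ forest D n l ++ X) (seq 1 n) /\
    (forall s, In s l -> t < s <= n).
Proof.
  revert t. induction k as [|k IH]; intros t Hk Ht x M A C s2 X HR Hx Hpx HP; [lia|].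
  rewrite subtree_eq in HP by lia.
  destruct (perm_not_in _ _ _ t HP ltac:(simpl; auto)) as [Ht1 _].
  assert (Hmove : forall a, incl a (children D n t) -> reach D n (t :: x :: M) (a ++ A, C) s2).
  { intros a Ha. apply reach_step with (A, C) s2; auto; try lia.
    - right; left. split; auto. apply in_children; auto.
    - apply stack_push. auto.
    - destruct s2 as [B C2]. apply (stack_push D n t [] B C2). easy. }
  destruct (children D n t) as [|c cs] eqn:Ec.
  - exists [], (t :: x :: M), C. repeat split.
    + apply (Hmove []). easy.
    + exists t, (x :: M). rewrite Ec, Hx. repeat split; simpl; auto; [lia|easy].
    + clear - HP. perm_tac HP.
    + easy.
    + easy.
  - assert (Hc : In c (children D n t)) by (rewrite Ec; simpl; auto).
    assert (Hg := in_children_gt D n t c hD Hc).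
    apply in_children in Hc as [Hc1 Hc2]; auto.
    destruct (IH c ltac:(lia) ltac:(lia) t (x :: M) (cs ++ A) C s2 (forest D n cs ++ X)
      (Hmove cs ltac:(intros z Hz; right; auto)) Hc2 ltac:(rewrite Hx; simpl; auto))
      as (l & M' & C' & HR' & HJ' & HP' & Hl).
    { clear - HP. perm_tac HP. }
    (* The siblings of [c] were pushed before the descent below [c], so here they lie under [l]. *)
    exists (l ++ cs), M', C'. rewrite <- app_assoc. repeat split; auto.
    + clear - HP'. perm_tac HP'.
    + apply in_app_iff in H as [H|H].
      * apply Hl in H. lia.
      * apply (in_children_gt D n t); auto. rewrite Ec. right; auto.
    + apply in_app_iff in H as [H|H].
      * apply Hl in H. lia.
      * apply (in_children_gt D n t); auto. rewrite Ec. right; auto.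
Qed.

(** The contract that lets visits of pending subtrees be composed: whatever is pushed meanwhile is
    removed again, and the final state allows another jump. *)
Definition clears (D n w : nat) : Prop :=
  forall M A C1 s2 X, reach D n M (w :: A, C1) s2 -> can_jump D n M ->
  Permutation (M ++ subtree D n w ++ X) (seq 1 n) ->
  exists M' C1' C2', reach D n M' (A, C1') (fst s2, C2') /\ can_jump D n M' /\
    Permutation (M' ++ X) (seq 1 n).

Lemma clears_all (D n : nat) (l : list nat) : (forall s, In s l -> clears D n s) ->
  forall M A C1 s2 X, reach D n M (l ++ A, C1) s2 -> can_jump D n M ->
  Permutation (M ++ forest D n l ++ X) (seq 1 n) ->
  exists M' C1' C2', reach D n M' (A, C1') (fst s2, C2') /\ can_jump D n M' /\
    Permutation (M' ++ X) (seq 1 n).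
Proof.
  induction l as [|w l IH]; intros Hl M A C1 s2 X HR HJ HP.
  - exists M, C1, (snd s2). destruct s2. auto.
  - destruct (Hl w ltac:(simpl; auto) M (l ++ A) C1 s2 (forest D n l ++ X) HR HJ)
      as (M1 & D1 & D2 & HR1 & HJ1 & HP1).
    { simpl in HP. rewrite <- app_assoc in HP. exact HP. }
    apply (IH ltac:(intros; apply Hl; simpl; auto) M1 A D1 (fst s2, D2) X HR1 HJ1 HP1).
Qed.

(** The roots left pending by the climb and the descent have larger labels than [w], so the
    induction hypothesis clears them. *)
Lemma clears_vertex (D n : nat) (hD : 3 <= D) (k w : nat) :
  n - w < k -> 2 <= w <= n -> clears D n w.
Proof.
  revert w. induction k as [|k IH]; intros w Hk Hw M A C1 [B C2] X HR HJ HP; [lia|].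
  rewrite subtree_eq in HP by lia. simpl fst.
  destruct (children D n w) as [|c cs] eqn:Ec.
  - destruct (reach_stack_par D n hD _ _ _ HR w ltac:(simpl; auto)) as [_ Hp].
    destruct (perm_not_in _ _ _ w HP ltac:(simpl; auto)) as [Hw1 _].
    exists (w :: M), (w :: C1), C2. split; [|split; [|clear - HP; perm_tac HP]].
    + destruct HJ as (x & M0 & -> & Hx & Hpx & Hc).
      apply reach_step with (w :: A, C1) (B, C2); auto; try lia.
      * right; right. repeat split; auto. rewrite leaf_children. auto.
      * apply (stack_pop D n w [] A C1). easy.
      * apply (stack_push D n w [] B C2). easy.
      * simpl; auto.
    + exists w, M. rewrite Ec. repeat split; simpl; auto; [lia|easy].
  - assert (Hc : In c (children D n w)) by (rewrite Ec; simpl; auto).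
    assert (Hg := in_children_gt D n w c hD Hc).
    apply in_children in Hc as [Hc1 Hc2]; auto.
    (* During this climb [w] belongs to the unvisited part; the climb ends at the first child [c]
       and leaves its pending roots [l] in the second page. *)
    destruct (climb D n hD k c ltac:(lia) ltac:(lia) M (w :: A, C1) B C2
      (w :: forest D n cs ++ X) HR HJ) as (l & M1 & C2' & HR1 & HP1 & Hl).
    { clear - HP. perm_tac HP. }
    { rewrite Hc2. simpl; auto. }
    destruct (reach_stack_par D n hD _ _ _ HR1 w ltac:(simpl; auto)) as [_ Hp].
    destruct (perm_not_in _ _ _ w HP1 ltac:(rewrite in_app_iff; simpl; auto)) as [Hw1 _].
    (* Rule (a) leads from [c] to [w], which is popped from the first page; the list [a] of pushed
       children stays open for the two cases below. *)
    assert (Hmove : forall a, incl a (children D n w) ->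
      reach D n (w :: c :: M1) (a ++ A, w :: C1) (l ++ B, C2')).
    { intros a Ha. apply reach_step with (w :: A, C1) (l ++ B, C2'); auto; try lia.
      - left. split; [lia|auto].
      - apply stack_pop. auto.
      - apply (stack_push D n w [] (l ++ B) C2'). easy.
      - simpl; auto. }
    assert (Hl' : forall s, In s l -> clears D n s).
    { intros s Hs. apply Hl in Hs. apply IH; lia. }
    (* If [c] is the only child, [w] itself allows the next jump and only [l] remains to be
       cleared. *)
    destruct cs as [|c2 cs].
    + destruct (clears_all D n l Hl' (w :: c :: M1) B C2' (A, w :: C1) X)
        as (M' & C1' & C2'' & HR' & HJ' & HP').
      * apply reach_sym. apply (Hmove []). easy.
      * exists w, (c :: M1). rewrite Ec. repeat split; [lia|right; auto|].
        intros z [<-|[]]. simpl; auto.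
      * clear - HP1. perm_tac HP1.
      * exists M', C2'', C1'. split; [|auto]. apply reach_sym. exact HR'.
    + assert (Hd : In c2 (children D n w)) by (rewrite Ec; simpl; auto).
      assert (Hg2 := in_children_gt D n w c2 hD Hd).
      apply in_children in Hd as [Hd1 Hd2]; auto.
      destruct (descend D n hD k c2 ltac:(lia) ltac:(lia) w (c :: M1) (cs ++ A) (w :: C1)
        (l ++ B, C2') (forest D n l ++ forest D n cs ++ X))
        as (l2 & M2 & C1' & HR2 & HJ2 & HP2 & Hl2); auto.
      { apply Hmove. intros z Hz. rewrite Ec. right; right; auto. }
      { right; right; auto. }
      { clear - HP1. perm_tac HP1. }
      (* The roots [l] lie in the second page, so [reach_sym] exchanges the pages for this call and
         back again afterwards. *)
      destruct (clears_all D n l Hl' M2 B C2' (l2 ++ cs ++ A, C1')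
        (forest D n (l2 ++ cs) ++ X)) as (M3 & C2b & C1b & HR3 & HJ3 & HP3); auto.
      { apply reach_sym. auto. }
      { clear - HP2. perm_tac HP2. }
      apply reach_sym in HR3. simpl in HR3. rewrite app_assoc in HR3.
      assert (Hl2' : forall s, In s (l2 ++ cs) -> clears D n s).
      { intros s Hs. apply in_app_iff in Hs as [Hs|Hs].
        - apply Hl2 in Hs. apply IH; lia.
        - assert (w < s <= n) by (apply (in_children_gt D n w); auto; rewrite Ec; right; right; auto).
          apply IH; lia. }
      destruct (clears_all D n (l2 ++ cs) Hl2' M3 A C1b (B, C2b) X HR3 HJ3 HP3)
        as (M' & C1'' & C2'' & H); auto.
      exists M', C1'', C2''. exact H.
Qed.

(** [can_jump] excludes the root, so the run opens with a descent through its first child, while the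
    other children wait in the first page. *)
Lemma reach_full (D n : nat) (hD : 3 <= D) (hn : 3 <= n) :
  exists M C1 C2, reach D n M ([], C1) ([], C2) /\ Permutation M (seq 1 n).
Proof.
  pose proof (subtree_root_perm D n hD ltac:(lia)) as HP.
  rewrite subtree_eq in HP by lia.
  assert (H2 : In 2 (children D n 1)).
  { apply in_children; auto. split; [lia|]. unfold par. rewrite Nat.Div0.div_0_l. reflexivity. }
  destruct (children D n 1) as [|c cs] eqn:Ec; [easy|].
  assert (Hc : In c (children D n 1)) by (rewrite Ec; simpl; auto).
  assert (Hg := in_children_gt D n 1 c hD Hc).
  apply in_children in Hc as [Hc1 Hc2]; auto.
  destruct (descend D n hD (S n) c ltac:(lia) ltac:(lia) 1 [] cs [] ([], []) (forest D n cs))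
    as (l & M & C & HR & HJ & HP' & Hl); auto.
  { apply (reach_root D n cs []); [rewrite Ec; intros z Hz; right; auto|easy]. }
  destruct (clears_all D n (l ++ cs)) with (M := M) (A := @nil nat) (C1 := C)
    (s2 := (@nil nat, @nil nat)) (X := @nil nat) as (M' & C1' & C2' & HR' & _ & HP''); auto.
  { intros s Hs. apply clears_vertex with (S n); auto; [lia|].
    apply in_app_iff in Hs as [Hs|Hs]; [apply Hl in Hs; lia|].
    assert (1 < s <= n) by (apply (in_children_gt D n 1); auto; rewrite Ec; right; auto). lia. }
  { rewrite app_nil_r. exact HR. }
  { clear - HP'. perm_tac HP'. }
  exists M', C1', C2'. rewrite app_nil_r in HP''. auto.
Qed.

(** * Two-page drawings *)

Definition tent (lo hi x : R) : R := (2 * (hi - lo) * Rmin (x - lo) (hi - x))%R.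

Lemma tent_nonneg (lo hi x : R) : (lo <= x <= hi -> 0 <= tent lo hi x)%R.
Proof.
  intros H. unfold tent. assert (0 <= Rmin (x - lo) (hi - x))%R by (apply Rmin_glb; lra). nra.
Qed.

Lemma tent_pos (lo hi x : R) : (lo < x < hi -> 0 < tent lo hi x)%R.
Proof.
  intros H. unfold tent. assert (0 < Rmin (x - lo) (hi - x))%R by (apply Rmin_glb_lt; lra). nra.
Qed.

(** The wider base gives a strictly larger slope, and the distance from [x] to its nearer end is
    positive and at least as large. *)
Lemma tent_nested (lo hi lo' hi' x : R) :
  (lo <= lo' -> hi' <= hi -> hi' - lo' < hi - lo -> lo < x < hi -> lo' <= x <= hi' ->
  tent lo' hi' x < tent lo hi x)%R.
Proof.
  intros H1 H2 H3 H4 H5. unfold tent.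
  assert (0 < Rmin (x - lo) (hi - x))%R by (apply Rmin_glb_lt; lra).
  assert (0 <= Rmin (x - lo') (hi' - x))%R by (apply Rmin_glb; lra).
  assert (Rmin (x - lo') (hi' - x) <= Rmin (x - lo) (hi - x))%R by (apply Rmin_glb;
    [eapply Rle_trans; [apply Rmin_l|lra] | eapply Rle_trans; [apply Rmin_r|lra]]).
  nra.
Qed.

(* The height [2 * (b - a)^2 * min s (1 - s)] makes longer edges steeper, so that
   nested edges of one page meet at most in a common endpoint. *)
Definition tent_arc (up : bool) (a b s : R) : pt :=
  ((a + s * (b - a))%R,
   ((if up then 1 else -1) * (2 * (b - a) * (b - a) * Rmin s (1 - s)))%R).

Lemma Rmin_scale (d p q : R) : (0 <= d -> Rmin (d * p) (d * q) = d * Rmin p q)%R.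
Proof.
  intros H. destruct (Rle_dec p q).
  - rewrite !Rmin_left; nra.
  - rewrite !Rmin_right; nra.
Qed.

(** Whatever the orientation of the edge, its arc is the graph of a function of the abscissa, so two
    arcs can be compared at a common abscissa. *)
Lemma tent_arc_graph (up : bool) (a b s : R) :
  snd (tent_arc up a b s) =
  ((if up then 1 else -1) * tent (Rmin a b) (Rmax a b) (fst (tent_arc up a b s)))%R.
Proof.
  unfold tent_arc, tent; simpl. f_equal.
  destruct (Rle_dec a b) as [h|h].
  - rewrite (Rmin_left a b), Rmax_right by lra.
    replace (a + s * (b - a) - a)%R with ((b - a) * s)%R by ring.
    replace (b - (a + s * (b - a)))%R with ((b - a) * (1 - s))%R by ring.
    rewrite Rmin_scale by lra. ring.
  - rewrite (Rmin_right a b), Rmax_left by lra.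
    replace (a + s * (b - a) - b)%R with ((a - b) * (1 - s))%R by ring.
    replace (a - (a + s * (b - a)))%R with ((a - b) * s)%R by ring.
    rewrite Rmin_scale, (Rmin_comm (1 - s)) by lra. ring.
Qed.

Lemma tent_arc_range (up : bool) (a b s : R) : (0 <= s <= 1)%R ->
  (Rmin a b <= fst (tent_arc up a b s) <= Rmax a b)%R.
Proof.
  intros H; simpl. unfold Rmin, Rmax. destruct (Rle_dec a b); nra.
Qed.

Lemma tent_arc_range_lt (up : bool) (a b s : R) : a <> b -> (0 < s < 1)%R ->
  (Rmin a b < fst (tent_arc up a b s) < Rmax a b)%R.
Proof.
  intros Hab H; simpl. unfold Rmin, Rmax. destruct (Rle_dec a b); nra.
Qed.

Lemma tent_arc_polygonal (up : bool) (a b : R) : a <> b -> polygonal_arc (tent_arc up a b).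
Proof.
  intros Hab. split.
  - exists [(1 / 2)%R; 1%R]. simpl. repeat split; try lra.
    + intros t Ht. unfold tent_arc, lerp; simpl.
      rewrite !(Rmin_left _ (1 - _)) by lra. f_equal; field.
    + intros t Ht. unfold tent_arc, lerp; simpl.
      rewrite !(Rmin_right _ (1 - _)) by lra. f_equal; field.
  - intros s s' _ _ H. injection H as H _. nra.
Qed.

Lemma INR_min (a b : nat) : INR (Nat.min a b) = Rmin (INR a) (INR b).
Proof.
  destruct (Nat.le_gt_cases a b) as [h|h].
  - rewrite Nat.min_l by lia. apply le_INR in h. rewrite Rmin_left; auto.
  - rewrite Nat.min_r by lia. apply lt_INR in h. rewrite Rmin_right; auto; lra.
Qed.

Lemma INR_max (a b : nat) : INR (Nat.max a b) = Rmax (INR a) (INR b).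
Proof.
  destruct (Nat.le_gt_cases a b) as [h|h].
  - rewrite Nat.max_r by lia. apply le_INR in h. rewrite Rmax_right; auto.
  - rewrite Nat.max_l by lia. apply lt_INR in h. rewrite Rmax_left; auto; lra.
Qed.

(* One-sided: only the case where the edge [a b] starts first. *)
Definition crosses (a b a' b' : nat) : Prop :=
  Nat.min a b < Nat.min a' b' < Nat.max a b /\ Nat.max a b < Nat.max a' b'.

(** At a common point the first height is nonzero, so the sign excludes opposite pages. In one page,
    non-crossing bases have disjoint interiors or are properly nested, and [tent_nested] separates
    nested tents. *)
Lemma tent_arcs_disjoint (up up' : bool) (a b a' b' : nat) (s s' : R) :
  a <> b -> a' <> b' ->
  (Nat.min a b <> Nat.min a' b' \/ Nat.max a b <> Nat.max a' b') ->
  (up = up' -> ~ crosses a b a' b' /\ ~ crosses a' b' a b) ->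
  (0 < s < 1)%R -> (0 <= s' <= 1)%R ->
  tent_arc up (INR a) (INR b) s <> tent_arc up' (INR a') (INR b') s'.
Proof.
  intros Hab Hab' Hne Hc Hs Hs' E.
  assert (Hx := f_equal fst E). assert (Hy := f_equal snd E).
  rewrite !tent_arc_graph in Hy.
  assert (H1 := tent_arc_range_lt up (INR a) (INR b) s (not_INR _ _ Hab) Hs).
  assert (H2 := tent_arc_range up' (INR a') (INR b') s' Hs').
  rewrite <- Hx in Hy, H2. revert H1 H2 Hy.
  generalize (fst (tent_arc up (INR a) (INR b) s)). intros x.
  rewrite <- !INR_min, <- !INR_max. unfold crosses in Hc.
  assert (Nat.min a b < Nat.max a b) by lia.
  assert (Nat.min a' b' < Nat.max a' b') by lia.
  revert Hne Hc H H0.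
  generalize (Nat.min a b) (Nat.max a b) (Nat.min a' b') (Nat.max a' b').
  intros l h l' h' Hne Hc Hl Hl' H1 H2 Hy.
  assert (P1 := tent_pos _ _ _ H1). assert (P2 := tent_nonneg _ _ _ H2).
  destruct (Bool.bool_dec up up') as [<-|Hup].
  2:{ destruct up, up'; try congruence; lra. }
  assert (Ht : tent (INR l) (INR h) x = tent (INR l') (INR h') x) by (destruct up; lra).
  specialize (Hc eq_refl).
  (* The sums compare the lengths [h - l] and [h' - l'] without truncated subtraction. *)
  assert (Hcase : h <= l' \/ h' <= l \/ (l <= l' /\ h' <= h /\ h' + l < h + l') \/
    (l' <= l /\ h <= h' /\ h + l' < h' + l)) by lia.
  destruct Hcase as [Hk|[Hk|[(K1 & K2 & K3)|(K1 & K2 & K3)]]].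
  - apply le_INR in Hk. lra.
  - apply le_INR in Hk. lra.
  - apply le_INR in K1, K2. apply lt_INR in K3. rewrite !plus_INR in K3.
    assert (Hn := tent_nested (INR l) (INR h) (INR l') (INR h') x K1 K2 ltac:(lra) H1 H2). lra.
  - apply le_INR in K1, K2. apply lt_INR in K3. rewrite !plus_INR in K3.
    assert (Hn := tent_nested (INR l') (INR h') (INR l) (INR h) x K1 K2 ltac:(lra) ltac:(lra) ltac:(lra)). lra.
Qed.

Lemma two_page_planar (n : nat) (E : nat -> nat -> bool) (tau : nat -> nat)
  (page : nat -> nat -> bool) :
  (forall x y, 1 <= x <= n -> 1 <= y <= n -> tau x = tau y -> x = y) ->
  (forall u w, E u w = true -> 1 <= u <= n /\ 1 <= w <= n) ->
  (forall u w u' w', u < w -> E u w = true -> u' < w' -> E u' w' = true ->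
     page u w = page u' w' -> ~ crosses (tau u) (tau w) (tau u') (tau w')) ->
  planar n E.
Proof.
  intros Hinj HE Hc.
  exists (fun x => (INR (tau x), 0%R)),
    (fun u w => tent_arc (page u w) (INR (tau u)) (INR (tau w))).
  assert (Hne : forall u w, u < w -> E u w = true -> tau u <> tau w).
  { intros u w Hu He Ht. destruct (HE u w He). apply Hinj in Ht; lia. }
  split; [|split].
  - intros x y Hx Hy H. injection H as H. apply INR_eq in H. auto.
  - intros u w Hu He. specialize (Hne u w Hu He). apply not_INR in Hne.
    split; [|split; [|split]].
    + apply tent_arc_polygonal; auto.
    + unfold tent_arc. rewrite Rmin_left by lra. f_equal; ring.
    + unfold tent_arc. rewrite Rmin_right by lra. f_equal; ring.
    + intros s x Hs Hx H. apply (f_equal snd) in H.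
      rewrite tent_arc_graph in H. simpl snd in H.
      assert (P := tent_pos _ _ _ (tent_arc_range_lt (page u w) _ _ s Hne Hs)).
      destruct (page u w); lra.
  - intros u w u' w' Hu He Hu' He' Hd s s' Hs Hs'.
    apply tent_arcs_disjoint; auto.
    destruct (HE _ _ He), (HE _ _ He').
    (* Equal end positions would make the edges equal; the exchanged match contradicts [u < w] and
       [u' < w']. *)
    assert (Hcase : (tau u = tau u' /\ tau w = tau w') \/ (tau u = tau w' /\ tau w = tau u') \/
      Nat.min (tau u) (tau w) <> Nat.min (tau u') (tau w') \/
      Nat.max (tau u) (tau w) <> Nat.max (tau u') (tau w')) by lia.
    destruct Hcase as [[h1 h2]|[[h1 h2]|Hcase]]; auto;
      apply Hinj in h1, h2; try tauto; [congruence|lia].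
Qed.

(** * Non-crossing of the edges of one page *)

(** The head is the latest visit, so times count from the end of the list, starting at 1; the value
    0 marks an unvisited vertex. *)
Fixpoint time (M : list nat) (x : nat) : nat :=
  match M with
  | [] => 0
  | y :: M' => if y =? x then length M else time M' x
  end.

Lemma time_head (M : list nat) (y : nat) : time (y :: M) y = S (length M).
Proof. simpl. rewrite Nat.eqb_refl. reflexivity. Qed.

Lemma time_le (M : list nat) (x : nat) : time M x <= length M.
Proof. induction M as [|y M IH]; simpl; [lia|]. destruct (y =? x); lia. Qed.

Lemma time_pos (M : list nat) (x : nat) : In x M -> 1 <= time M x.
Proof.
  induction M as [|y M IH]; simpl; [easy|]. destruct (Nat.eqb_spec y x); [lia|].
  intros [H|H]; [easy|auto].
Qed.

Lemma time_old (M : list nat) (x y : nat) : In x M -> ~ In y M -> time (y :: M) x = time M x.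
Proof. intros Hx Hy. simpl. destruct (Nat.eqb_spec y x); congruence. Qed.

Lemma time_nth (M : list nat) (k : nat) : NoDup M -> 1 <= k <= length M ->
  time M (nth (length M - k) M 0) = k.
Proof.
  induction M as [|y M IH]; intros HN Hk; simpl in Hk; [lia|]. inversion HN; subst.
  destruct (Nat.eq_dec k (S (length M))) as [->|Hne].
  - simpl length. rewrite Nat.sub_diag. apply time_head.
  - simpl length. replace (S (length M) - k) with (S (length M - k)) by lia. simpl nth.
    rewrite time_old; auto; [apply IH; auto; lia|]. apply nth_In. lia.
Qed.

Lemma nth_time (M : list nat) (x : nat) : In x M -> nth (length M - time M x) M 0 = x.
Proof.
  induction M as [|y M IH]; [easy|]. intros Hx. simpl time.
  destruct (Nat.eqb_spec y x) as [e|e].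
  - rewrite Nat.sub_diag. exact e.
  - destruct Hx as [Hx|Hx]; [easy|]. pose proof (time_le M x).
    simpl length. replace (S (length M) - time M x) with (S (length M - time M x)) by lia.
    apply IH. exact Hx.
Qed.

(* The clause for a pending [x] and a popped [w] is what yields the last clause,
   non-crossing of popped edges, when [x] is popped in turn. *)
Definition stack_inv (D : nat) (M : list nat) (s : list nat * list nat) : Prop :=
  let (A, C) := s in
  (forall x, In x A -> In (par D x) M) /\
  StronglySorted ge (map (fun x => time M (par D x)) A) /\
  (forall w, In w C -> In w M /\ In (par D w) M /\ time M (par D w) < time M w) /\
  (forall x w, In x A -> In w C ->
     ~ (time M (par D w) < time M (par D x) < time M w)) /\
  (forall w w', In w C -> In w' C ->
     ~ (time M (par D w) < time M (par D w') < time M w /\ time M w < time M w')).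

Lemma stack_inv_visit (D y : nat) (M A C : list nat) :
  ~ In y M -> stack_inv D M (A, C) -> stack_inv D (y :: M) (A, C).
Proof.
  intros Hy (H1 & H2 & H3 & H4 & H5). repeat split.
  - intros x Hx. right. auto.
  - rewrite (map_ext_in _ (fun x => time M (par D x))); auto.
    intros x Hx. apply time_old; auto.
  - right. apply H3; auto.
  - right. apply H3; auto.
  - destruct (H3 w H) as (h1 & h2 & h3). rewrite !time_old; auto.
  - intros x w Hx Hw. destruct (H3 w Hw) as (h1 & h2 & h3). rewrite !time_old; auto.
  - intros w w' Hw Hw'. destruct (H3 w Hw) as (h1 & h2 & h3), (H3 w' Hw') as (k1 & k2 & k3).
    rewrite !time_old; auto.
Qed.

Lemma stack_inv_pop (D y : nat) (M A C : list nat) :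
  ~ In y M -> stack_inv D M (y :: A, C) -> stack_inv D (y :: M) (A, y :: C).
Proof.
  intros Hy H. assert (Hpy : In (par D y) M) by (destruct H as [H _]; apply H; simpl; auto).
  apply (stack_inv_visit D y M) in H; auto.
  destruct H as (H1 & H2 & H3 & H4 & H5).
  assert (Ht := time_head M y).
  assert (Hty : time (y :: M) (par D y) <= length M)
    by (rewrite time_old; auto; apply time_le).
  cbn [map] in H2. apply StronglySorted_inv in H2 as [H2a H2b]. rewrite Forall_map, Forall_forall in H2b.
  repeat split.
  - intros x Hx. apply H1. right; auto.
  - auto.
  - destruct H as [<-|H]; [simpl; auto|apply H3; auto].
  - destruct H as [<-|H]; [right; auto|apply H3; auto].
  - destruct H as [<-|H]; [lia|apply H3; auto].
  (* Sortedness: the parent of each [x] left in the stack is no later than the parent of [y], hence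
     not strictly inside the edge of [y]. *)
  - intros x w Hx [<-|Hw]; [|apply H4; auto; right; auto].
    specialize (H2b x Hx). cbv beta in H2b. lia.
  - intros w w' [<-|Hw] [<-|Hw'].
    + lia.
    + pose proof (time_le (y :: M) w') as h. simpl length in h. lia.
    + intros [h _]. apply (H4 y w); auto. simpl; auto.
    + apply H5; auto.
Qed.

(** The new entries hang from [y], the latest vertex: this keeps the order, and no popped edge
    reaches beyond [y]. *)
Lemma stack_inv_push (D n y : nat) (hD : 3 <= D) (M a A C : list nat) :
  incl a (children D n y) -> stack_inv D (y :: M) (A, C) -> stack_inv D (y :: M) (a ++ A, C).
Proof.
  intros Ha (H1 & H2 & H3 & H4 & H5).
  assert (Hp : forall x, In x a -> par D x = y).
  { intros x Hx. apply Ha, in_children in Hx; tauto. }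
  assert (Ht := time_head M y).
  repeat split; auto; try (apply H3; auto).
  - intros x Hx. apply in_app_iff in Hx as [Hx|Hx]; auto. rewrite Hp; simpl; auto.
  - clear Ha. induction a as [|x a IH]; auto. cbn [app map]. constructor.
    + apply IH. intros; apply Hp; right; auto.
    + rewrite Forall_forall. intros z Hz. rewrite Hp, Ht by (left; auto).
      apply in_map_iff in Hz as [u [<- _]]. unfold ge. apply (time_le (y :: M)).
  - intros x w Hx Hw. apply in_app_iff in Hx as [Hx|Hx]; [|auto].
    rewrite (Hp x Hx), Ht. pose proof (time_le (y :: M) w) as h. simpl length in h. lia.
Qed.

Lemma stack_inv_step (D n y : nat) (hD : 3 <= D) (M : list nat) s t :
  ~ In y M -> stack_inv D M s -> stack_step D n y s t -> stack_inv D (y :: M) t.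
Proof.
  intros Hy Hs Hst. destruct Hst as [a A C Ha|a A C Ha]; apply (stack_inv_push D n); auto.
  - apply stack_inv_visit; auto.
  - apply stack_inv_pop; auto.
Qed.

Lemma reach_stack_inv (D n : nat) (hD : 3 <= D) M s1 s2 : reach D n M s1 s2 ->
  stack_inv D M s1 /\ stack_inv D M s2.
Proof.
  induction 1 as [a b Ha Hb|x y M s1 s2 t1 t2 Hr IH Hy Hyn Hg H1 H2 Hp].
  - assert (H0 : stack_inv D [1] ([], [])).
    { repeat split; simpl; try easy. constructor. }
    split; [rewrite <- (app_nil_r a)|rewrite <- (app_nil_r b)];
      apply (stack_inv_push D n 1 hD []); auto.
  - split; eapply stack_inv_step; eauto; apply IH.
Qed.

(** As rule (a) has priority, a vertex is left only for its parent or after its parent was visited;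
    hence the clause on [tl M], which omits the current vertex. *)
Lemma reach_history (D n : nat) (hD : 3 <= D) (hn : 1 <= n) M s1 s2 : reach D n M s1 s2 ->
  NoDup M /\ (forall z, In z M -> 1 <= z <= n) /\ last M 0 = 1 /\
  (forall z, In z (tl M) -> z = 1 \/ In (par D z) M).
Proof.
  induction 1 as [a b Ha Hb|x y M s1 s2 t1 t2 Hr (I1 & I2 & I3 & I4) Hy Hyn Hg H1 H2 Hp].
  - repeat split; simpl in *; try lia; try tauto; try (intuition lia).
    constructor; [easy|constructor].
  - split; [constructor; auto|split; [|split]].
    + intros z [<-|Hz]; auto.
    + exact I3.
    + intros z [<-|Hz].
      * destruct Hg as [[Hg1 Hg2]|[[[Hg1|Hg1] _]|[Hg1 [Hg2 _]]]]; subst; simpl in *; auto.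
      * destruct (I4 z Hz); simpl in *; auto.
Qed.

Lemma reach_steps (D n : nat) M s1 s2 : reach D n M s1 s2 ->
  forall l y x M', M = l ++ y :: x :: M' -> good_step D n (x :: M') x y.
Proof.
  induction 1 as [a b Ha Hb|x y M s1 s2 t1 t2 Hr IH Hy Hyn Hg H1 H2 Hp];
    intros [|z l] y' x' M' HM; simpl in HM; inversion HM; subst; auto.
  - destruct l; discriminate.
  - eapply IH; eauto.
Qed.

Lemma stack_step_popped (D n y : nat) s t w : stack_step D n y s t ->
  In w (snd s) -> In w (snd t).
Proof. intros []; simpl; auto. Qed.

(** The edge above [w] is settled at the visit of its later end. If that is [w], the last premise of
    [reach_step] applies; if it is the parent, [w] must come immediately before it. *)
Lemma reach_tree_edges (D n : nat) (hD : 3 <= D) (hn : 1 <= n) M s1 s2 : reach D n M s1 s2 ->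
  forall w, w <> 1 -> In w M -> In (par D w) M ->
  S (time M (par D w)) = time M w \/ S (time M w) = time M (par D w) \/
  In w (snd s1) \/ In w (snd s2).
Proof.
  induction 1 as [a b Ha Hb|x y M s1 s2 t1 t2 Hr IH Hy Hyn Hg H1 H2 Hp]; intros w Hw1 Hw Hpw.
  - destruct Hw; [congruence|easy].
  - destruct (reach_history D n hD hn _ _ _ Hr) as (_ & R2 & _ & R4).
    assert (Hold : forall z, In z (x :: M) -> time (y :: x :: M) z = time (x :: M) z)
      by (intros; apply time_old; auto).
    assert (Hgt : forall z, 2 <= z -> par D z <> z)
      by (intros z Hz; pose proof (par_bounds D z hD Hz); lia).
    destruct Hw as [<-|Hw].
    + destruct Hpw as [e|Hpw]; [destruct (Hgt y); [lia|auto]|].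
      rewrite time_head, Hold by auto.
      destruct (Hp Hpw) as [e|Hpop]; [|auto].
      left. rewrite e, time_head. reflexivity.
    + rewrite (Hold w Hw). destruct Hpw as [e|Hpw].
      * right; left. rewrite <- e, time_head.
        destruct Hw as [<-|Hw]; [rewrite time_head; reflexivity|].
        (* A vertex earlier than [x] already has a visited parent, whereas [y] is new. *)
        destruct (R4 w Hw) as [h|h]; [easy|]. exfalso.
        rewrite <- e in h. exact (Hy h).
      * rewrite (Hold _ Hpw). destruct (IH w Hw1 Hw Hpw) as [h|[h|[h|h]]]; auto.
        -- right; right; left. eapply stack_step_popped; eauto.
        -- right; right; right. eapply stack_step_popped; eauto.
Qed.

(** * Properties of the output graph *)

Definition enumerates (n : nat) (v tau : nat -> nat) : Prop :=
  (forall k, 1 <= k <= n -> 1 <= v k <= n /\ tau (v k) = k) /\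
  (forall x, 1 <= x <= n -> 1 <= tau x <= n /\ v (tau x) = x).

Lemma marked_iff (n : nat) (v tau : nat -> nat) (k x : nat) :
  enumerates n v tau -> 1 <= k <= n -> 1 <= x <= n ->
  marked v k x = true <-> tau x <= k.
Proof.
  intros [H1 H2] Hk Hx. unfold marked. rewrite existsb_exists.
  destruct (H2 x Hx) as [Ht Hvt]. split.
  - intros (i & Hi & He). apply in_seq in Hi. apply Nat.eqb_eq in He. subst x.
    destruct (H1 i ltac:(lia)) as [_ ->]. lia.
  - intros Hle. exists (tau x). rewrite in_seq, Nat.eqb_eq. split; [lia|auto].
Qed.

Lemma caseA_iff (D n : nat) (hD : 3 <= D) (v tau : nat -> nat) (k : nat) :
  enumerates n v tau -> 1 <= k <= n ->
  caseA D v k = true <-> v k <> 1 /\ k < tau (par D (v k)).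
Proof.
  intros He Hk. unfold caseA. rewrite andb_true_iff, !negb_true_iff, Nat.eqb_neq.
  rewrite <- not_true_iff_false.
  pose proof (proj1 (proj1 He k Hk)) as Hv.
  destruct (Nat.eq_dec (v k) 1) as [e|e]; [tauto|].
  pose proof (par_bounds D (v k) hD ltac:(lia)).
  rewrite (marked_iff n v tau) by (auto; lia). lia.
Qed.

Lemma caseB_iff (D n : nat) (hD : 3 <= D) (v tau : nat -> nat) (k : nat) :
  enumerates n v tau -> 1 <= k <= n ->
  caseB D n v k = true <-> exists c, In c (children D n (v k)) /\ k < tau c.
Proof.
  intros He Hk. unfold caseB. rewrite existsb_exists.
  split; intros (c & H1 & H2); exists c.
  - apply in_seq in H1. apply andb_true_iff in H2 as [H2 H3].
    rewrite negb_true_iff, <- not_true_iff_false, (marked_iff n v tau) in H3 by (auto; lia).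
    split; [|lia]. apply in_children; auto. apply child_par; auto.
  - apply in_children in H1; auto. rewrite in_seq, andb_true_iff, (child_par D n _ c hD).
    rewrite negb_true_iff, <- not_true_iff_false, (marked_iff n v tau) by (auto; lia).
    intuition lia.
Qed.

Definition page_inv (D : nat) (tau : nat -> nat) (C : list nat) : Prop :=
  (forall w, In w C -> tau (par D w) < tau w) /\
  (forall w w', In w C -> In w' C ->
     ~ (tau (par D w) < tau (par D w') < tau w /\ tau w < tau w')).

Lemma time_suffix (l M : list nat) (z : nat) : NoDup (l ++ M) ->
  In z (l ++ M) -> In z M <-> time (l ++ M) z <= length M.
Proof.
  induction l as [|y l IH]; intros HN Hz; simpl app in *.
  - split; auto. intros _. apply time_le.
  - inversion HN; subst. destruct (Nat.eq_dec y z) as [->|e].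
    + rewrite time_head, length_app. split; [|lia].
      intros H. exfalso. rewrite in_app_iff in *. tauto.
    + destruct Hz as [Hz|Hz]; [easy|]. rewrite time_old by auto. auto.
Qed.

Lemma split_at (M : list nat) (k : nat) : 1 <= k < length M ->
  exists l M', M = l ++ nth (length M - S k) M 0 :: nth (length M - k) M 0 :: M' /\
    S (length M') = k.
Proof.
  intros Hk.
  destruct (nth_split M 0 (n := length M - S k) ltac:(lia)) as (l & M1 & HM & Hl).
  assert (HL := f_equal (@length nat) HM). rewrite length_app in HL. simpl in HL.
  destruct M1 as [|x M']; simpl in HL; [lia|].
  exists l, M'. split; [|lia].
  replace (nth (length M - k) M 0) with x; auto.
  rewrite HM at 2. rewrite app_nth2 by lia.
  replace (length M - k - length l) with 1 by lia. reflexivity.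
Qed.

Lemma nth_length_pred (M : list nat) (d : nat) :
  1 <= length M -> nth (length M - 1) M d = last M d.
Proof.
  induction M as [|x [|y M] IH]; simpl length; intros H; [lia|reflexivity|].
  specialize (IH ltac:(simpl; lia)). simpl length in IH.
  replace (S (length M) - 1) with (length M) in IH by lia.
  replace (S (S (length M)) - 1) with (S (length M)) by lia.
  exact IH.
Qed.

Lemma exists_execution (D n : nat) (hD : 3 <= D) (hn : 3 <= n) :
  exists v tau C1 C2, enumerates n v tau /\ execution D n v /\
    page_inv D tau C1 /\ page_inv D tau C2 /\
    (forall w, 2 <= w <= n -> S (tau (par D w)) = tau w \/ S (tau w) = tau (par D w) \/
       In w C1 \/ In w C2).
Proof.
  destruct (reach_full D n hD hn) as (M & C1 & C2 & HR & HP).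
  destruct (reach_history D n hD ltac:(lia) _ _ _ HR) as (HN & Hb & Hlast & _).
  destruct (reach_stack_inv D n hD _ _ _ HR) as [HS1 HS2].
  assert (Hlen : length M = n) by (rewrite (Permutation_length HP); apply length_seq).
  assert (Hin : forall x, 1 <= x <= n -> In x M).
  { intros x Hx. apply (Permutation_in _ (Permutation_sym HP)), in_seq. lia. }
  (* [M] lists the latest visit first, so the [k]-th vertex sits at index [n - k]; the default 0 is
     not reached for [1 <= k <= n]. *)
  set (v := fun k => nth (n - k) M 0).
  assert (He : enumerates n v (time M)).
  { unfold v. rewrite <- Hlen. split.
    - intros k Hk. split; [rewrite Hlen; apply Hb, nth_In; lia|apply time_nth; auto].
    - intros x Hx. rewrite Hlen in Hx. split; [|apply nth_time; auto].
      split; [apply time_pos; auto|apply time_le]. }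
  assert (Hpage : forall C, stack_inv D M ([], C) -> page_inv D (time M) C).
  { intros C (_ & _ & H3 & _ & H5). split; auto. apply H3. }
  exists v, (time M), C1, C2. split; [exact He|split; [|split; [|split]]]; auto.
  2:{ intros w Hw. pose proof (par_bounds D w hD ltac:(lia)).
      apply (reach_tree_edges D n hD ltac:(lia) _ _ _ HR); auto; [lia| |]; apply Hin; lia. }
  assert (Hv1 : v 1 = 1).
  { unfold v. rewrite <- Hlen, nth_length_pred by lia. exact Hlast. }
  split; [exact Hv1|]. intros k Hk1 Hkn.
  destruct (split_at M k ltac:(lia)) as (l & M' & HM & HM').
  assert (Hstep := reach_steps D n _ _ _ HR _ _ _ _ HM).
  rewrite Hlen in HM, Hstep. fold (v k) (v (S k)) in HM, Hstep. clearbody v.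
  (* The first [k] visits form the suffix headed by [v k], which turns the list conditions of
     [good_step] into conditions on times. *)
  assert (Hmem : forall z, In z (v k :: M') <-> 1 <= z <= n /\ time M z <= k).
  { intros z. assert (HM2 : M = (l ++ [v (S k)]) ++ v k :: M')
      by (rewrite <- app_assoc; exact HM).
    assert (Hz : In z M -> (In z (v k :: M') <-> time M z <= k)).
    { intros Hz. pose proof (time_suffix (l ++ [v (S k)]) (v k :: M') z) as h.
      rewrite <- HM2 in h. rewrite (h HN Hz).
      simpl length. rewrite HM'. reflexivity. }
    split.
    - intros H. assert (Hz' : In z M) by (rewrite HM2; apply in_app_iff; auto).
      split; [auto|apply Hz; auto].
    - intros [H1 H2]. apply Hz; auto. }
  destruct (proj1 He k ltac:(lia)) as [Hvk Htk].
  destruct (proj1 He (S k) ltac:(lia)) as [Hvk' Htk'].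
  pose proof (caseA_iff D n hD v (time M) k He ltac:(lia)) as HA.
  pose proof (caseB_iff D n hD v (time M) k He ltac:(lia)) as HB.
  assert (Hun : marked v k (v (S k)) = false).
  { rewrite <- not_true_iff_false, (marked_iff n v (time M)) by (auto; lia). lia. }
  destruct Hstep as [[S1 S2]|[[S1 S2]|[S1 [S2 [S3 S4]]]]].
  - rewrite <- S2, Htk' in HA. rewrite (proj2 HA) by lia. exact S2.
  - destruct (caseA D v k) eqn:EA.
    { exfalso. destruct (proj1 HA eq_refl) as [h1 h2]. destruct S1 as [S1|S1]; [easy|].
      apply Hmem in S1. lia. }
    rewrite (proj2 HB).
    + split; auto. apply child_par; auto. apply in_children in S2; auto.
    + exists (v (S k)). split; auto. lia.
  - destruct (caseA D v k) eqn:EA.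
    { exfalso. destruct (proj1 HA eq_refl) as [h1 h2]. apply Hmem in S2. lia. }
    destruct (caseB D n v k) eqn:EB; [|auto].
    exfalso. destruct (proj1 HB eq_refl) as (c & h1 & h2). apply S3, Hmem in h1. lia.
Qed.

Definition jump_edge (D n : nat) (v : nat -> nat) (x y : nat) : Prop :=
  exists k, 1 <= k < n /\ jump D n v k = true /\ v k = x /\ v (S k) = y.

Lemma output_iff (D n : nat) (hD : 3 <= D) (v : nat -> nat) (x y : nat) :
  output D n v x y = true <->
  1 <= x <= n /\ 1 <= y <= n /\ x <> y /\
  (In y (children D n x) \/ In x (children D n y) \/
   jump_edge D n v x y \/ jump_edge D n v y x \/ (v n = x /\ y = 1) \/ (v n = y /\ x = 1)).
Proof.
  unfold output, jump_edge.
  rewrite !andb_true_iff, !orb_true_iff, !andb_true_iff, !Nat.leb_le, negb_true_iff, Nat.eqb_neq,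
    !Nat.eqb_eq, !child_par, !in_children, existsb_exists by auto.
  assert (H : (exists k, In k (seq 1 (n - 1)) /\ jump D n v k &&
      ((v k =? x) && (v (S k) =? y) || (v k =? y) && (v (S k) =? x)) = true) <->
    (exists k, 1 <= k < n /\ jump D n v k = true /\ v k = x /\ v (S k) = y) \/
    (exists k, 1 <= k < n /\ jump D n v k = true /\ v k = y /\ v (S k) = x)).
  { split.
    - intros (k & H1 & H2). apply in_seq in H1.
      rewrite andb_true_iff, orb_true_iff, !andb_true_iff, !Nat.eqb_eq in H2.
      destruct H2 as [H2 [H3|H3]]; [left|right]; exists k; intuition lia.
    - intros [(k & H1 & H2 & H3 & H4)|(k & H1 & H2 & H3 & H4)]; exists k;
        rewrite in_seq, andb_true_iff, orb_true_iff, !andb_true_iff, !Nat.eqb_eq;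
        intuition lia. }
  rewrite H. tauto.
Qed.

Lemma output_simple (D n : nat) (hD : 3 <= D) (v : nat -> nat) : simple_graph n (output D n v).
Proof.
  split; [|split].
  - intros x y H. apply output_iff in H; tauto.
  - intros x y. apply eq_true_iff_eq. rewrite !output_iff by auto. intuition.
  - intros x. apply not_true_iff_false. rewrite output_iff by auto. tauto.
Qed.

(** Nothing lies strictly between consecutive points, and the closing edge joins the extreme points,
    so such edges cross nothing; [page_inv] handles the popped tree edges. *)
Lemma output_planar (D n : nat) (hD : 3 <= D) (v tau : nat -> nat) (C1 C2 : list nat) :
  v 1 = 1 -> enumerates n v tau -> page_inv D tau C1 -> page_inv D tau C2 ->
  (forall w, 2 <= w <= n -> S (tau (par D w)) = tau w \/ S (tau w) = tau (par D w) \/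
     In w C1 \/ In w C2) ->
  planar n (output D n v).
Proof.
  intros Hv1 [He1 He2] [P1 Q1] [P2 Q2] Htree.
  (* The larger end of a tree edge is the child, so the page may depend on the second end alone. *)
  apply two_page_planar with (tau := tau)
    (page := fun _ w => if in_dec Nat.eq_dec w C1 then true else false).
  - intros x y Hx Hy H. rewrite <- (proj2 (He2 x Hx)), <- (proj2 (He2 y Hy)). congruence.
  - intros u w H. apply output_iff in H; tauto.
  - intros u w u' w' Hu HE Hu' HE' Hp [X1 X2].
    assert (Hkind : forall a b, a < b -> output D n v a b = true ->
      (1 <= tau a <= n /\ 1 <= tau b <= n) /\
      (tau a = S (tau b) \/ tau b = S (tau a) \/ (Nat.min (tau a) (tau b) = 1 /\
        Nat.max (tau a) (tau b) = n) \/ (par D b = a /\ (In b C1 \/ In b C2)))).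
    { intros a b Hab H. apply output_iff in H as (Ha & Hb & _ & H); auto.
      split; [split; apply He2; auto|].
      assert (Hj : forall x y, jump_edge D n v x y -> tau y = S (tau x)).
      { intros x y (k & Hk & _ & <- & <-).
        rewrite (proj2 (He1 k ltac:(lia))), (proj2 (He1 (S k) ltac:(lia))). reflexivity. }
      destruct H as [H|[H|[H|[H|[[<- ->]|[<- ->]]]]]]; auto.
      - apply in_children in H as [H <-]; auto. destruct (Htree b H) as [h|[h|h]]; auto.
      - apply in_children_gt in H; auto. lia.
      - lia.
      - assert (Ht1 := proj2 (He1 1 ltac:(lia))). rewrite Hv1 in Ht1.
        rewrite Ht1, (proj2 (He1 n ltac:(lia))). lia. }
    destruct (Hkind u w Hu HE) as [B1 K1], (Hkind u' w' Hu' HE') as [B2 K2].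
    destruct K1 as [K1|[K1|[K1|[<- K1]]]]; try lia.
    destruct K2 as [K2|[K2|[K2|[<- K2]]]]; try lia.
    assert (HC : (In w C1 /\ In w' C1) \/ (In w C2 /\ In w' C2)).
    { destruct (in_dec Nat.eq_dec w C1), (in_dec Nat.eq_dec w' C1); try discriminate; tauto. }
    destruct HC as [[c c']|[c c']].
    + specialize (Q1 w w' c c'). apply P1 in c, c'. lia.
    + specialize (Q2 w w' c c'). apply P2 in c, c'. lia.
Qed.

(** * Hamiltonian cycle *)

Lemma execution_step_edge (D n : nat) (hD : 3 <= D) (v tau : nat -> nat) (k : nat) :
  enumerates n v tau -> execution D n v -> 1 <= k < n -> output D n v (v k) (v (S k)) = true.
Proof.
  intros He [_ Hx] Hk. apply output_iff; auto.
  destruct (proj1 He k ltac:(lia)) as [h1 h2], (proj1 He (S k) ltac:(lia)) as [h3 h4].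
  split; [|split; [|split]]; auto; [intros e; rewrite e in h2; lia|].
  specialize (Hx k ltac:(lia) ltac:(lia)).
  destruct (caseA D v k) eqn:EA; [|destruct (caseB D n v k) eqn:EB].
  - right; left. apply (caseA_iff D n hD v tau) in EA; auto; [|lia].
    apply in_children; auto. split; [lia|auto].
  - left. destruct Hx as [Hx _]. apply child_par in Hx; auto. apply in_children; auto.
  - right; right; left. exists k. unfold jump. rewrite EA, EB. auto.
Qed.

Lemma map_seq_walk (E : nat -> nat -> bool) (v : nat -> nat) (m i : nat) :
  (forall k, i <= k < i + m -> E (v k) (v (S k)) = true) ->
  walk E (v i) (map v (seq (S i) m)) (v (i + m)) = true.
Proof.
  revert i. induction m as [|m IH]; intros i H; simpl.
  - rewrite Nat.add_0_r. apply Nat.eqb_refl.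
  - rewrite H by lia. replace (i + S m) with (S i + m) by lia. apply IH. intros; apply H; lia.
Qed.

Lemma last_map_seq (v : nat -> nat) (m i : nat) :
  last (map v (seq (S i) m)) (v i) = v (i + m).
Proof.
  destruct m as [|m]; simpl seq; [simpl; f_equal; lia|].
  change (S i :: seq (S (S i)) m) with (seq (S i) (S m)).
  rewrite seq_S, map_app. simpl map. rewrite last_last. f_equal; lia.
Qed.

Lemma output_hamiltonian (D n : nat) (hD : 3 <= D) (hn : 3 <= n) (v tau : nat -> nat) :
  enumerates n v tau -> execution D n v -> hamiltonian n (output D n v).
Proof.
  intros He Hx. exists (v 1), (map v (seq 2 (n - 1))).
  assert (Hmap : v 1 :: map v (seq 2 (n - 1)) = map v (seq 1 n)).
  { destruct n; [lia|]. simpl. rewrite Nat.sub_0_r. reflexivity. }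
  rewrite Hmap, last_map_seq. replace (1 + (n - 1)) with n by lia.
  split; [|split; [|split; [|split]]].
  - apply NoDup_map_NoDup_ForallPairs; [|apply seq_NoDup].
    intros i j Hi Hj H. apply in_seq in Hi, Hj. apply (f_equal tau) in H.
    rewrite (proj2 (proj1 He i ltac:(lia))), (proj2 (proj1 He j ltac:(lia))) in H. exact H.
  - rewrite length_map, length_seq. reflexivity.
  - intros x H. apply in_map_iff in H as (i & <- & Hi). apply in_seq in Hi. apply He. lia.
  - replace (v n) with (v (1 + (n - 1))) by (f_equal; lia). apply map_seq_walk.
    intros k Hk. apply execution_step_edge with tau; auto. lia.
  - destruct (proj1 He 1 ltac:(lia)) as [h1 h2], (proj1 He n ltac:(lia)) as [h3 h4].
    apply output_iff; auto. rewrite (proj1 Hx) in *.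
    split; [|split; [|split]]; auto; [|tauto]. intros e. rewrite e in h4. lia.
Qed.

(** * Maximum degree *)

Lemma child_before_parent (D n : nat) (hD : 3 <= D) (v tau : nat -> nat) (c x : nat) :
  enumerates n v tau -> execution D n v ->
  In c (children D n x) -> tau c < tau x -> tau x = S (tau c).
Proof.
  intros He [_ Hx] Hc Hlt. apply in_children in Hc as [Hc <-]; auto.
  pose proof (par_bounds D c hD ltac:(lia)).
  destruct (proj2 He c ltac:(lia)) as [t1 t2], (proj2 He (par D c) ltac:(lia)) as [t3 t4].
  (* At time [tau c] the parent of [c] is unmarked, so rule (a) moves to it at once. *)
  specialize (Hx (tau c) ltac:(lia) ltac:(lia)).
  rewrite (proj2 (caseA_iff D n hD v tau (tau c) He t1)) in Hx by (rewrite t2; lia).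
  rewrite t2 in Hx. rewrite <- Hx. apply He. lia.
Qed.

(* A child visited before its parent is visited immediately before it, so there is at most one. *)
Lemma children_before_parent (D n : nat) (hD : 3 <= D) (v tau : nat -> nat) (x : nat) :
  enumerates n v tau -> execution D n v ->
  (forall c, In c (children D n x) -> tau c < tau x) -> length (children D n x) <= 1.
Proof.
  intros He Hx H.
  apply (NoDup_incl_length (l' := [v (tau x - 1)])); [apply NoDup_children|].
  intros c Hc. left. pose proof (child_before_parent D n hD v tau c x He Hx Hc (H c Hc)) as h.
  rewrite h. simpl. rewrite Nat.sub_0_r. apply in_children in Hc as [Hc _]; auto.
  apply He. lia.
Qed.

(** A jump leaves [x] only after all its children, of which there is then at most one, and enters
    only leaves. So a vertex other than the root has at most three neighbours, or just its parent
    and at most [D - 1] children. At the root the closing edge replaces the parent. *)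
Lemma output_degree (D n : nat) (hD : 3 <= D) (hn : 3 <= n) (v tau : nat -> nat) :
  enumerates n v tau -> execution D n v -> max_degree_le n (output D n v) D.
Proof.
  intros He Hx x Hxn.
  assert (Hbound : forall l, (forall y, output D n v x y = true -> In y l) -> length l <= D ->
    length (filter (output D n v x) (seq 1 n)) <= D).
  { intros l Hl Hle. apply Nat.le_trans with (length l); auto.
    apply NoDup_incl_length; [apply NoDup_filter, seq_NoDup|].
    intros y Hy. apply filter_In in Hy as [_ Hy]. auto. }
  pose proof (length_children D n x) as Hlen.
  destruct (proj2 He x Hxn) as [Htx Hvx].
  assert (Hin : forall y, jump_edge D n v y x -> children D n x = [] /\ x <> 1 /\ y = v (tau x - 1)).
  { intros y (k & Hk & Hj & <- & <-). destruct Hx as [_ Hx]. specialize (Hx k ltac:(lia) ltac:(lia)).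
    unfold jump in Hj. apply andb_true_iff in Hj as [hA hB]. rewrite negb_true_iff in hA, hB.
    rewrite hA, hB in Hx. destruct Hx as [Hx _]. apply leaf_children in Hx as [Hx1 Hx2].
    rewrite (proj2 (proj1 He (S k) ltac:(lia))). simpl. rewrite Nat.sub_0_r.
    repeat split; auto. lia. }
  assert (Hout : forall y, jump_edge D n v x y ->
    tau x < n /\ y = v (S (tau x)) /\ forall c, In c (children D n x) -> tau c < tau x).
  { intros y (k & Hk & Hj & <- & <-). rewrite (proj2 (proj1 He k ltac:(lia))).
    repeat split; try lia. intros c Hc.
    unfold jump in Hj. apply andb_true_iff in Hj as [_ hB].
    rewrite negb_true_iff, <- not_true_iff_false, (caseB_iff D n hD v tau) in hB by (auto; lia).
    assert (tau c <> k).
    { intros e. pose proof (in_children_gt D n _ c hD Hc).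
      pose proof (proj2 (proj2 He c ltac:(lia))). rewrite e in *. lia. }
    destruct (Nat.le_gt_cases (tau c) k); [lia|]. exfalso. eauto. }
  assert (Ht1 : tau 1 = 1).
  { rewrite <- (proj1 Hx) at 1. apply He. lia. }
  destruct (Nat.eq_dec x 1) as [->|Hx1].
  - apply (Hbound (v n :: children D n 1)); [|simpl; lia].
    intros y Hy. apply output_iff in Hy as (_ & Hyn & Hne & Hy); auto.
    destruct Hy as [Hy|[Hy|[Hy|[Hy|[[Hy _]|[Hy _]]]]]].
    + right; auto.
    + apply in_children_gt in Hy; auto. lia.
    + destruct (Hout y Hy) as (_ & _ & h).
      assert (H2 : In 2 (children D n 1)).
      { apply in_children; auto. split; [lia|]. unfold par. rewrite Nat.Div0.div_0_l. reflexivity. }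
      apply h in H2. pose proof (proj1 (proj2 He 2 ltac:(lia))). lia.
    + apply Hin in Hy. tauto.
    + pose proof (proj2 (proj1 He n ltac:(lia))) as h. rewrite Hy in h. lia.
    + left; auto.
  (* [next] merges the target of a jump out of [x] with the end [1] of the closing edge when [x]
     comes last. *)
  - set (next := if tau x =? n then 1 else v (S (tau x))).
    assert (Hall : forall y, output D n v x y = true ->
      In y (children D n x) \/ y = par D x \/
      (y = next /\ forall c, In c (children D n x) -> tau c < tau x) \/
      (y = v (tau x - 1) /\ children D n x = [])).
    { intros y Hy. apply output_iff in Hy as (_ & Hyn & Hne & Hy); auto.
      destruct Hy as [Hy|[Hy|[Hy|[Hy|[[Hy ->]|[Hy h]]]]]]; auto.
      - apply in_children in Hy as [_ <-]; auto.
      - apply Hout in Hy as (h1 & h2 & h3). right; right; left. split; auto.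
        unfold next. destruct (Nat.eqb_spec (tau x) n); [lia|auto].
      - apply Hin in Hy. tauto.
      - right; right; left. pose proof (proj2 (proj1 He n ltac:(lia))) as h. rewrite Hy in h.
        unfold next. rewrite h, Nat.eqb_refl. split; auto.
        intros c Hc. apply in_children_gt in Hc; auto.
        destruct (proj2 He c ltac:(lia)) as [h1 h2].
        assert (tau c <> n) by (intros e; rewrite e in h2; lia). lia.
      - easy. }
    destruct (children D n x) as [|c cs] eqn:Ec.
    + apply (Hbound [par D x; next; v (tau x - 1)]); [|simpl; lia].
      intros y Hy. apply Hall in Hy. simpl. intuition.
    + destruct (forallb (fun c => tau c <? tau x) (c :: cs)) eqn:Ef.
      * apply (Hbound (par D x :: next :: c :: cs)).
        { intros y Hy. apply Hall in Hy. simpl in *. intuition congruence. }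
        pose proof (children_before_parent D n hD v tau x He Hx) as h. rewrite Ec in h.
        rewrite forallb_forall in Ef.
        assert (length (c :: cs) <= 1).
        { apply h. intros d Hd. apply Nat.ltb_lt. auto. }
        simpl in *; lia.
      * apply (Hbound (par D x :: c :: cs)); [|simpl in *; lia].
        intros y Hy. apply Hall in Hy as [Hy|[Hy|[[_ Hy]|[_ Hy]]]]; simpl; auto; [|easy].
        exfalso. apply not_true_iff_false in Ef. apply Ef, forallb_forall.
        intros d Hd. apply Nat.ltb_lt. auto.
Qed.

(** * Diameter *)

Lemma walk_app (E : nat -> nat -> bool) (p q : list nat) (x y z : nat) :
  walk E x p y = true -> walk E y q z = true -> walk E x (p ++ q) z = true.
Proof.
  revert x. induction p as [|a p IH]; intros x; simpl.
  - intros H. apply Nat.eqb_eq in H as ->. auto.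
  - rewrite !andb_true_iff. intros [H1 H2] H3. auto.
Qed.

Lemma walk_rev (E : nat -> nat -> bool) (HE : forall x y, E x y = E y x) (p : list nat) (x y : nat) :
  walk E x p y = true -> exists q, length q = length p /\ walk E y q x = true.
Proof.
  revert x. induction p as [|a p IH]; intros x; simpl.
  - intros H. exists []. simpl. rewrite Nat.eqb_sym. auto.
  - rewrite andb_true_iff. intros [H1 H2]. destruct (IH a H2) as (q & H3 & H4).
    exists (q ++ [x]). rewrite length_app. split; [simpl; lia|].
    apply walk_app with a; auto. simpl. rewrite HE, H1, Nat.eqb_refl. reflexivity.
Qed.

Lemma walk_to_root (D n : nat) (hD : 3 <= D) (E : nat -> nat -> bool) :
  (forall x, 2 <= x <= n -> E x (par D x) = true) ->
  forall f x, 1 <= x <= n -> x <= f ->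
  exists p, length p = depth_aux D f x /\ walk E x p 1 = true.
Proof.
  intros HE f. induction f as [|f IH]; intros x Hx Hf; [lia|]. simpl.
  destruct (Nat.leb_spec x 1).
  - exists []. replace x with 1 by lia. auto.
  - pose proof (par_bounds D x hD ltac:(lia)).
    destruct (IH (par D x) ltac:(lia) ltac:(lia)) as (p & H1 & H2).
    exists (par D x :: p). simpl. rewrite H1, H2, HE by lia. auto.
Qed.

Lemma depth_le_height (D n x : nat) : 1 <= x <= n -> depth D x <= height D n.
Proof.
  intros Hx. unfold height. assert (Hi : In x (seq 1 n)) by (apply in_seq; lia).
  induction (seq 1 n) as [|a l IH]; [easy|]. simpl. destruct Hi as [->|Hi]; [lia|].
  specialize (IH Hi). lia.
Qed.

(** Tree edges suffice: climb from [x] to the root, then follow the reversed climb from [y]. *)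
Lemma output_diameter (D n : nat) (hD : 3 <= D) (v : nat -> nat) :
  diameter_le n (output D n v) (2 * height D n).
Proof.
  assert (HE : forall x, 2 <= x <= n -> output D n v x (par D x) = true).
  { intros x Hx. pose proof (par_bounds D x hD ltac:(lia)). apply output_iff; auto.
    rewrite !in_children by auto. intuition lia. }
  intros x y Hx Hy.
  destruct (walk_to_root D n hD _ HE x x Hx (le_n x)) as (p & Hp1 & Hp2).
  destruct (walk_to_root D n hD _ HE y y Hy (le_n y)) as (q & Hq1 & Hq2).
  apply walk_rev in Hq2 as (r & Hr1 & Hr2); [|apply output_simple; auto].
  exists (p ++ r). split; [|apply walk_app with 1; auto].
  rewrite length_app, Hp1, Hr1, Hq1.
  pose proof (depth_le_height D n x Hx). pose proof (depth_le_height D n y Hy).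
  unfold depth in *. lia.
Qed.

Theorem mainTheorem8 (D n : nat) (hD : 3 <= D) (hn : 3 <= n) :
  (exists v : nat -> nat, execution D n v /\ planar n (output D n v)) /\
  (exists E : nat -> nat -> bool,
      simple_graph n E /\ planar n E /\ hamiltonian n E /\
      max_degree_le n E D /\ diameter_le n E (2 * height D n)).
Proof.
  destruct (exists_execution D n hD hn) as (v & tau & C1 & C2 & He & Hx & H1 & H2 & Ht).
  assert (Hp : planar n (output D n v)).
  { apply output_planar with tau C1 C2; auto. apply Hx. }
  split; [exists v; auto|]. exists (output D n v).
  split; [|split; [|split; [|split]]]; auto.
  - apply output_simple; auto.
  - apply output_hamiltonian with tau; auto.
  - apply output_degree with tau; auto.
  - apply output_diameter; auto.
Qed.
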